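(* For any sentence $\varphi$ of first-order infinitely valued Łukasiewicz logic $\mathcal{L}^{[0,1]_{\mathrm{L}}}(\tau)$, there is a unique $a\in[0,1]$ such that $\lim_{n}\mu_{n}(\varphi\in V)=1$ for any open interval $V$ containing $a$. Equivalently, $\lim_{n}\mu_{n}(|\varphi-a|<\varepsilon)=1$ for any $\varepsilon>0$.
   Context: Let $\tau$ be a finite purely relational vocabulary and let $[0,1]_{\mathrm{L}}=\langle[0,1],\wedge,\vee,\rightarrow,\lnot\rangle$ be the standard MV-algebra ($\wedge,\vee$ are min and max, $\rightarrow$ and $\lnot$ are Łukasiewicz implication and negation). Formulas of $\mathcal{L}^{[0,1]_{\mathrm{L}}}(\tau)$ are built from atomic formulas $R(x_1,\dots,x_{\tau(R)})$, $R\in\tau$, using these connectives and the quantifiers $\forall,\exists$. A model $\mathfrak{M}$ with domain $M$ assigns to each $R\in\tau$ a map $R^{\mathfrak{M}}\colon M^{\tau(R)}\to[0,1]$; the value $\|\varphi\|^{\mathfrak{M}}$ is computed by interpreting connectives in $[0,1]_{\mathrm{L}}$ and $\forall,\exists$ as infimum and supremum. The logic is assumed to have a crisp identity $\approx$ (interpreted as the characteristic function of the diagonal). For each $R\in\tau$ fix a $\sigma$-additive Borel probability measure $p_R$ on $[0,1]$ giving positive measure to every non-trivial interval (e.g. Lebesgue measure). These induce the product measure $\rho_n$ on the space $\mathrm{Mod}^{[0,1]}_{\tau,n}=\prod_{R\in\tau}[0,1]^{[n]^{\tau(R)}}$ of $[0,1]$-valued $\tau$-structures with domain $[n]=\{1,\dots,n\}$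 (so the values of distinct atomic statements $R(i_1,\dots,i_k)$ are independent, each distributed according to $p_R$), and for a sentence $\varphi$ and measurable $S\subseteq[0,1]$ one defines $\mu_n(\varphi\in S)=\rho_n\{\mathfrak{M}\in\mathrm{Mod}^{[0,1]}_{\tau,n}:\|\varphi\|^{\mathfrak{M}}\in S\}$.
   Formalization: Every relation symbol R in the vocabulary is required to have arity at least 1; with a nullary R the claim fails, since the value of the sentence R has law p_R for every n and so does not concentrate at any a. *)

(* Defs.v *)
From HB Require Import structures.
From mathcomp Require Import all_boot all_order all_algebra.
From mathcomp Require Import interval_inference.
From mathcomp Require Import all_classical all_reals all_analysis.
Set Implicit Arguments.
Unset Strict Implicit.
Unset Printing Implicit Defensive.
Import Order.TTheory GRing.Theory Num.Theory.
Import numFieldNormedType.Exports.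
Local Open Scope classical_set_scope.
Local Open Scope ring_scope.

HB.instance Definition _ (R : realType) :=
  isPointed.Build {i01 R} (0%:i01 : {i01 R}).

(* [0,1] with its Borel sigma-algebra, i.e. the trace of that of R. *)
Definition unit_itv (R : realType) : Type :=
  g_sigma_algebra_preimageType
    (fun x : {i01 R} => x%:num : measurableTypeR R).
HB.instance Definition _ (R : realType) := Measurable.on (unit_itv R).

Definition unit_val (R : realType) (x : unit_itv R) : R :=
  (x : {i01 R})%:num.

Definition charges_intervals (R : realType) (p : probability (unit_itv R) R) :
    Prop :=
  forall J : set R, is_interval J -> J `<=` `[0, 1]%classic ->
    (exists x y, [/\ J x, J y & x < y]) ->
    (0 < p (@unit_val R @^-1` J))%E.

(* Well-scoped de Bruijn syntax: the variables of a formula k are the elements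
   of 'I_k, and a quantifier binds the variable 0 of its body. *)
Inductive formula (tau : Type) (ar : tau -> nat) : nat -> Type :=
| FAtom k (P : tau) (args : (ar P).-tuple 'I_k) : formula ar k
| FIdent k (i j : 'I_k) : formula ar k
| FAnd k (f g : formula ar k) : formula ar k
| FOr k (f g : formula ar k) : formula ar k
| FImp k (f g : formula ar k) : formula ar k
| FNeg k (f : formula ar k) : formula ar k
| FAll k (f : formula ar k.+1) : formula ar k
| FEx k (f : formula ar k.+1) : formula ar k.

Definition sentence (tau : Type) (ar : tau -> nat) : Type := formula ar 0.

Definition luk_imp (R : realType) (x y : R) : R := Num.min 1 (1 - x + y).
Definition luk_neg (R : realType) (x : R) : R := 1 - x.

Definition model (R : realType) (tau : Type) (ar : tau -> nat) (M : Type) :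
  Type := forall P : tau, (ar P).-tuple M -> unit_itv R.

(* For inhabited M the real inf and sup below are those of [0,1], all values
   being in [0,1]; on the empty domain they are the default 0. *)
Fixpoint eval (R : realType) (tau : Type) (ar : tau -> nat) (M : Type)
    (m : model R ar M) (k : nat) (phi : formula ar k) : k.-tuple M -> R :=
  match phi in formula _ k return k.-tuple M -> R with
  | FAtom _ P args => fun e => unit_val (m P (map_tuple (tnth e) args))
  | FIdent _ i j => fun e => (`[< tnth e i = tnth e j >])%:R
  | FAnd _ f g => fun e => Num.min (eval m f e) (eval m g e)
  | FOr _ f g => fun e => Num.max (eval m f e) (eval m g e)
  | FImp _ f g => fun e => luk_imp (eval m f e) (eval m g e)
  | FNeg _ f => fun e => luk_neg (eval m f e)
  | FAll _ f => fun e => inf (range (fun x => eval m f (cons_tuple x e)))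
  | FEx _ f => fun e => sup (range (fun x => eval m f (cons_tuple x e)))
  end.

Definition truth_value (R : realType) (tau : Type) (ar : tau -> nat)
    (M : Type) (m : model R ar M) (phi : sentence ar) : R :=
  eval m phi [tuple].

Section model_measurable.
Context (R : realType) (tau : Type) (ar : tau -> nat) (M : Type).

HB.instance Definition _ := gen_eqMixin (model R ar M).
HB.instance Definition _ := gen_choiceMixin (model R ar M).
HB.instance Definition _ :=
  isPointed.Build (model R ar M) (fun _ _ => point).

(* The product sigma-algebra: generated by the evaluations m |-> m P t. *)
Definition model_cylinder : set (set (model R ar M)) :=
  [set C | exists (P : tau) (t : (ar P).-tuple M) (A : set (unit_itv R)),
    measurable A /\ C = [set m | A (m P t)]].

Let model_set0 : <<s model_cylinder >> set0.
Proof. exact: sigma_algebra0. Qed.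

Let model_setC A : <<s model_cylinder >> A -> <<s model_cylinder >> (~` A).
Proof. exact: sigma_algebraC. Qed.

Let model_bigcup (F : (set (model R ar M))^nat) :
  (forall i, <<s model_cylinder >> (F i)) ->
  <<s model_cylinder >> (\bigcup_i F i).
Proof. exact: sigma_algebra_bigcup. Qed.

Definition model_display : measure_display.
Proof. exact: default_measure_display. Qed.

HB.instance Definition _ := @isMeasurable.Build model_display
  (model R ar M) <<s model_cylinder >> model_set0 model_setC model_bigcup.

End model_measurable.

Section tuple_prob.
Context d (T : measurableType d) (R : realType).

Definition tuple0_prob : set (0.-tuple T) -> \bar R :=
  \d_([tuple] : 0.-tuple T).
HB.instance Definition _ := Measure.on tuple0_prob.
Let tuple0_setT : tuple0_prob setT = 1%E.
Proof. by rewrite /tuple0_prob diracT. Qed.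
HB.instance Definition _ :=
  Measure_isProbability.Build _ _ R tuple0_prob tuple0_setT.

Definition pair_cons n (x : T * n.-tuple T) : n.+1.-tuple T :=
  cons_tuple x.1 x.2.
Let measurable_pair_cons n : measurable_fun setT (@pair_cons n).
Proof. exact: measurable_cons. Qed.
HB.instance Definition _ n := isMeasurableFun.Build _ _ _ _
  (@pair_cons n) (@measurable_pair_cons n).

Fixpoint tuple_prob n :
    ('I_n -> probability T R) -> probability (n.-tuple T) R :=
  match n return ('I_n -> probability T R) -> probability (n.-tuple T) R with
  | 0 => fun _ => tuple0_prob
  | n.+1 => fun p =>
     distribution (p ord0 \x tuple_prob (fun i => p (lift ord0 i)))%E
       (@pair_cons n)
  end.

Lemma tuple_probE n (p : 'I_n -> probability T R) (A : 'I_n -> set T) :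
  (forall i, measurable (A i)) ->
  tuple_prob p [set t | forall i, A i (tnth t i)] = (\prod_(i < n) p i (A i))%E.
Proof.
elim: n => [|n IHn] in p A *; move=> mA.
  rewrite big_ord0 /= (_ : [set _ | _] = setT) ?probability_setT//.
  by apply/seteqP; split => // t _ [].
rewrite big_ord_recl /= /distribution /pushforward /=.
rewrite -IHn; last by move=> i; exact: mA.
rewrite [X in product_measure1 _ _ X](_ : _ = A ord0 `*`
   [set t | forall i, A (lift ord0 i) (tnth t i)]); last first.
  apply/seteqP; split=> [[x t] /= H|[x t] /= [H0 H] i].
    by split=> [|i]; [exact: (H ord0)|have := H (lift ord0 i); rewrite tnthS].
  by case: (unliftP ord0 i) => [j ->|->//]; rewrite tnthS.
rewrite product_measure1E//.
rewrite [X in measurable X](_ : _ =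
    \bigcap_(i in [set: 'I_n]) ((fun t : n.-tuple T => tnth t i) @^-1` A (lift ord0 i))).
  apply: fin_bigcap_measurable => // i _.
  by rewrite -[X in measurable X]setTI; exact: (@measurable_tnth _ T n i).
by apply/seteqP; split=> [t /= H i _|t /= H i]; exact: H.
Qed.

End tuple_prob.

Section random_model.
Context (R : realType) (tau : finType) (ar : tau -> nat).
Variable p : tau -> probability (unit_itv R) R.
Variable n : nat.

Let atom : finType := {P : tau & (ar P).-tuple 'I_n}.

Definition model_of_tuple (v : #|atom|.-tuple (unit_itv R)) :
    model R ar 'I_n :=
  fun P t => tnth v (enum_rank (Tagged (fun P => (ar P).-tuple 'I_n) t : atom)).

Let measurable_model_of_tuple : measurable_fun setT model_of_tuple.
Proof.
apply: (@measurability _ _ _ _ _ _ (@model_cylinder R tau ar 'I_n)) => //.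
move=> _ [_ [P [t [A [mA ->]]]] <-].
exact: (@measurable_tnth _ (unit_itv R) _ (enum_rank (Tagged _ t : atom))).
Qed.

HB.instance Definition _ := isMeasurableFun.Build _ _ _ _
  model_of_tuple measurable_model_of_tuple.

(* The values of the atomic statements P(t) are independent with law p P. *)
Definition rho : probability (model R ar 'I_n) R :=
  distribution (tuple_prob (fun i : 'I_#|atom| => p (tag (enum_val i))))
    model_of_tuple.

(* This determines rho, the boxes being a pi-system that generates. *)
Lemma rhoE (A : forall P : tau, (ar P).-tuple 'I_n -> set (unit_itv R)) :
  (forall P t, measurable (A P t)) ->
  rho [set m | forall P t, A P t (m P t)] =
  (\prod_(P : tau) \prod_(t : (ar P).-tuple 'I_n) p P (A P t))%E.
Proof.
move=> mA.
pose q := tuple_prob (fun i : 'I_#|atom| => p (tag (enum_val i))).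
transitivity (q [set v | forall i,
    A (tag (enum_val i)) (tagged (enum_val i)) (tnth v i)]).
  rewrite -[LHS]/(q (model_of_tuple @^-1` [set m | forall P t, A P t (m P t)])).
  congr (q _); apply/seteqP; split=> [v /= H i|v /= H P t].
    have := H (tag (enum_val i)) (tagged (enum_val i)).
    rewrite /model_of_tuple (_ : Tagged _ _ = enum_val i) ?enum_valK//.
    by case: (enum_val i).
  have := H (enum_rank (Tagged (fun P => (ar P).-tuple 'I_n) t : atom)).
  by rewrite enum_rankK.
rewrite (@tuple_probE _ (unit_itv R) R _ _ (fun i : 'I_#|atom| =>
  A (tag (enum_val i)) (tagged (enum_val i)))); last by move=> i; exact: mA.
rewrite sig_big_dep/=.
by rewrite [RHS](reindex _ (onW_bij _ (enum_val_bij atom))).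
Qed.

Definition mu (phi : sentence ar) (S : set R) : \bar R :=
  rho [set m | S (truth_value m phi)].

End random_model.

(* Main.v *)
From mathcomp Require Import all_boot all_order all_algebra.
From mathcomp Require Import interval_inference.
From mathcomp Require Import all_classical all_reals all_analysis measurable_realfun.
From mathcomp Require Import ring lra.
Require Import Defs.
Import Order.TTheory GRing.Theory Num.Theory.
Import numFieldNormedType.Exports.
Local Open Scope classical_set_scope.
Local Open Scope ring_scope.
Set Implicit Arguments.
Unset Strict Implicit.
Unset Printing Implicit Defensive.

(* Back and forth with tolerance. Call tuples of two models similar when they
   have the same equality pattern and their atomic values differ by at most d.
   If every tuple of both models can be extended by a fresh element realizing
   any prescribed configuration of new atomic values up to d, then similarity
   propagates through quantifiers without loss (old atoms keep their error, new
   ones are only d apart), and by induction the values of a formula on similar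
   tuples differ by at most C d, where C depends only on the formula. With
   positive arities the empty tuples are always similar. For a fixed k-tuple and
   a fixed configuration, taken from a finite grid, the events that the various
   fresh elements realize it are independent with probability at least c > 0,
   so the extension property fails with probability O(n^k (1 - c/2)^n). Hence
   with probability tending to 1 the values of a sentence lie within C d of one
   another, across all large n, and letting d tend to 0 isolates the limit a. *)

(** * Suprema and infima of subsets of the unit interval *)

Section unit_interval.
Context (R : realType).
Implicit Types (A B : set R) (c x y : R).

Lemma unit_val_itv (u : unit_itv R) : 0 <= unit_val u <= 1.
Proof.
have h0 : 0 <= (u : {i01 R})%:num by [].
have h1 : (u : {i01 R})%:num <= 1 by [].
by rewrite /unit_val h0 h1.
Qed.

Lemma has_sup_unit A : A !=set0 -> A `<=` `[0, 1] -> has_sup A.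
Proof. by move=> A0 A1; split=> //; exists 1 => x /A1/=; rewrite in_itv/= => /andP[]. Qed.

Lemma has_inf_unit A : A !=set0 -> A `<=` `[0, 1] -> has_inf A.
Proof. by move=> A0 A1; split=> //; exists 0 => x /A1/=; rewrite in_itv/= => /andP[]. Qed.

Lemma sup_unit A : A !=set0 -> A `<=` `[0, 1] -> 0 <= sup A <= 1.
Proof.
move=> A0 A1; have [x Ax] := A0; have := A1 _ Ax; rewrite /= in_itv/= => /andP[x0 _].
apply/andP; split.
  by apply: le_trans x0 _; apply: sup_upper_bound => //; exact: has_sup_unit.
by apply: ge_sup => // y /A1/=; rewrite in_itv/= => /andP[].
Qed.

Lemma inf_unit A : A !=set0 -> A `<=` `[0, 1] -> 0 <= inf A <= 1.
Proof.
move=> A0 A1; have [x Ax] := A0; have := A1 _ Ax; rewrite /= in_itv/= => /andP[_ x1].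
apply/andP; split; first by apply: lb_le_inf => // y /A1/=; rewrite in_itv/= => /andP[].
by apply: le_trans x1; apply: inf_lbound => //; have [] := has_inf_unit A0 A1.
Qed.

(** Each set is dominated by the other shifted by [c]. The two matching hypotheses are what back and
    forth supplies at a quantifier. *)
Lemma dist_sup_le A B c : A !=set0 -> B !=set0 ->
    A `<=` `[0, 1] -> B `<=` `[0, 1] ->
    (forall x, A x -> exists2 y, B y & `|x - y| <= c) ->
    (forall y, B y -> exists2 x, A x & `|x - y| <= c) ->
  `|sup A - sup B| <= c.
Proof.
move=> A0 B0 A1 B1 AB BA.
have supA := sup_upper_bound (has_sup_unit A0 A1).
have supB := sup_upper_bound (has_sup_unit B0 B1).
rewrite ler_distl lerBlDr; apply/andP; split; last first.
  apply: ge_sup => // x /AB[y By]; rewrite ler_distl => /andP[_ xy].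
  by rewrite (le_trans xy)// lerD2r; exact: supB.
apply: ge_sup => // y /BA[x Ax]; rewrite ler_distl lerBlDr => /andP[yx _].
by rewrite (le_trans yx)// lerD2r; exact: supA.
Qed.

Lemma dist_inf_le A B c : A !=set0 -> B !=set0 ->
    A `<=` `[0, 1] -> B `<=` `[0, 1] ->
    (forall x, A x -> exists2 y, B y & `|x - y| <= c) ->
    (forall y, B y -> exists2 x, A x & `|x - y| <= c) ->
  `|inf A - inf B| <= c.
Proof.
move=> A0 B0 A1 B1 AB BA.
have infA := inf_lbound (has_inf_unit A0 A1).2.
have infB := inf_lbound (has_inf_unit B0 B1).2.
rewrite ler_distl; apply/andP; split.
  apply: lb_le_inf => // x /AB[y By]; rewrite ler_distl => /andP[xy _].
  by rewrite (le_trans _ xy)// lerD2r; exact: infB.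
rewrite -lerBlDr; apply: lb_le_inf => // y /BA[x Ax]; rewrite ler_distl => /andP[_ yx].
by rewrite lerBlDr (le_trans _ yx)//; exact: infA.
Qed.

End unit_interval.

(** * Back and forth between models with the extension property *)

Section back_and_forth.
Context (R : realType) (tau : finType) (ar : tau -> nat).

Lemma eval_itv (M : Type) (x0 : M) (m : model R ar M) k (f : formula ar k) e :
  0 <= eval m f e <= 1.
Proof.
elim: f e => {k} [k P args|k i j|k f IHf g IHg|k f IHf g IHg|k f IHf g IHg|k f IHf
  |k f IHf|k f IHf] e /=.
- exact: unit_val_itv.
- by case: asbool; rewrite /= ?lexx ?ler01.
- by rewrite ge_min le_min; case/andP: (IHf e) => -> ->; case/andP: (IHg e) => -> ->.
- by rewrite le_max ge_max; case/andP: (IHf e) => -> ->; case/andP: (IHg e) => -> ->.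
- rewrite /luk_imp; move: (IHf e) (IHg e); set u := eval _ _ _; set v := eval _ _ _.
  by rewrite le_min ge_min lexx; lra.
- by rewrite /luk_neg; move: (IHf e); lra.
- apply: inf_unit; first by exists (eval m f (cons_tuple x0 e)), x0.
  by move=> _ [x _ <-]; rewrite /= in_itv/=.
- apply: sup_unit; first by exists (eval m f (cons_tuple x0 e)), x0.
  by move=> _ [x _ <-]; rewrite /= in_itv/=.
Qed.

(* The closed ball of radius 1/(N+1) around the grid point i/(N+1). *)
Definition grid_cell N (i : nat) : set (unit_itv R) :=
  [set u | `|unit_val u - i%:R / N.+1%:R| <= N.+1%:R^-1].

Lemma grid_cell_dist N i u v : grid_cell N i u -> grid_cell N i v ->
  `|unit_val u - unit_val v| <= N.+1%:R^-1 *+ 2.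
Proof.
rewrite /grid_cell /= => iu; rewrite distrC => iv.
by rewrite mulr2n (le_trans (ler_distD (i%:R / N.+1%:R) _ _))// lerD.
Qed.

Lemma grid_cell_cover N u : exists i : 'I_N.+2, grid_cell N i u.
Proof.
have /andP[u0 u1] := unit_val_itv u.
have N0 : 0 < N.+1%:R :> R by rewrite ltr0n.
have uN0 : 0 <= unit_val u * N.+1%:R by rewrite mulr_ge0// ltW.
have /andP[lb ub] := truncn_itv uN0.
set i := Num.truncn _ in lb ub.
(* The value 1 truncates to [N.+1], which is why there are [N.+2] cells. *)
have iN : (i < N.+2)%N.
  rewrite ltnS -(ler_nat R) (le_trans lb)//.
  by rewrite ler_piMl// ltW.
exists (Ordinal iN); rewrite /grid_cell/= ler_distl.
have -> : i%:R / N.+1%:R - N.+1%:R^-1 = (i%:R - 1) / N.+1%:R :> R.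
  by rewrite mulrBl mul1r.
have -> : i%:R / N.+1%:R + N.+1%:R^-1 = (i%:R + 1) / N.+1%:R :> R.
  by rewrite mulrDl mul1r.
by rewrite ler_pdivrMr// ler_pdivlMr//; move: ub; rewrite -natr1; lra.
Qed.

(* Atoms are indexed by first occurrences in s, so that a tuple with repeated
   entries never puts two different constraints on the same atomic statement. *)
Definition pattern_index (M : eqType) k (s : k.+1.-tuple M) r (t : r.-tuple M) :
    r.-tuple 'I_k.+1 :=
  map_tuple (fun y => inord (index y s)) t.

(** These are the atoms that adding [x] to [e] brings in. For distinct [x] outside [e] they form
    disjoint families, the source of independence. *)
Definition fresh_atom (M : eqType) k (e : k.-tuple M) (x : M) r (t : r.-tuple M) :=
  (x \in t) && all [in x :: e] t.

Definition realizes (M : eqType) N k (m : model R ar M) (e : k.-tuple M)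
    (w : {P : tau & (ar P).-tuple 'I_k.+1} -> nat) (x : M) :=
  forall P (t : (ar P).-tuple M), fresh_atom e x t ->
    grid_cell N (w (Tagged (fun P => (ar P).-tuple 'I_k.+1)
                      (pattern_index (cons_tuple x e) t))) (m P t).

Definition extension_prop (M : eqType) N k (m : model R ar M) :=
  forall (e : k.-tuple M) (w : {ffun {P : tau & (ar P).-tuple 'I_k.+1} -> 'I_N.+2}),
    exists2 x, x \notin e & realizes N m e (fun a => w a) x.

(** The tolerant version of a partial isomorphism sending the entries of [e] to those of [e']. *)
Definition similar (d : R) (M M' : eqType) k (m : model R ar M) (m' : model R ar M')
    (e : k.-tuple M) (e' : k.-tuple M') :=
  (forall i j, (tnth e i == tnth e j) = (tnth e' i == tnth e' j)) /\
  (forall P (s : (ar P).-tuple 'I_k),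
     `|unit_val (m P (map_tuple (tnth e) s)) -
       unit_val (m' P (map_tuple (tnth e') s))| <= d).

Lemma similarC d (M M' : eqType) k (m : model R ar M) (m' : model R ar M')
    (e : k.-tuple M) (e' : k.-tuple M') :
  similar d m m' e e' -> similar d m' m e' e.
Proof. by case=> h1 h2; split=> [i j|P s]; rewrite ?h1// distrC. Qed.

Lemma map_tuple_comp (S T U : Type) (f : T -> U) (g : S -> T) (h : S -> U) r
    (s : r.-tuple S) : (forall x, h x = f (g x)) ->
  map_tuple h s = map_tuple f (map_tuple g s).
Proof. by move=> hfg; apply: val_inj; rewrite /= -map_comp; exact: eq_map. Qed.

(** Normalizing replaces a position by the first one with the same entry in [s']; as [s] has the
    same equality pattern, its entry there does not change either. *)
Lemma pattern_indexK (M M' : eqType) k (s : k.+1.-tuple M) (s' : k.+1.-tuple M') r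
    (a : r.-tuple 'I_k.+1) :
    (forall i j, (tnth s i == tnth s j) = (tnth s' i == tnth s' j)) ->
  map_tuple (tnth s) (pattern_index s' (map_tuple (tnth s') a)) = map_tuple (tnth s) a.
Proof.
move=> ss'; apply: eq_from_tnth => i; rewrite !tnth_map.
apply/eqP; rewrite ss'.
have h : tnth s' (tnth a i) \in (s' : seq M') by exact: mem_tnth.
have lt : (index (tnth s' (tnth a i)) s' < k.+1)%N.
  by rewrite -[X in (_ < X)%N](size_tuple s') index_mem.
by rewrite (tnth_nth (tnth s' (tnth a i))) inordK// nth_index.
Qed.

(** The tolerance does not grow: old atoms keep their error, and each new atom of [m'] is put in the
    grid cell of its counterpart in [m], hence within two radii of it. *)
Lemma similar_extend N (M M' : eqType) k (m : model R ar M) (m' : model R ar M')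
    (e : k.-tuple M) (e' : k.-tuple M') (x : M) :
    extension_prop N k m' -> similar (N.+1%:R^-1 *+ 2) m m' e e' ->
  exists x', similar (N.+1%:R^-1 *+ 2) m m' (cons_tuple x e) (cons_tuple x' e').
Proof.
move=> ext [ee' matom].
have [/tnthP[i0 xi0]|xe] := boolP (x \in e).
  exists (tnth e' i0).
  (* Sending position 0 to [i0] makes both extended tuples reindexings of [e] and [e'] by the same
     map. *)
  pose h (j : 'I_k.+1) := odflt i0 (unlift ord0 j).
  have hE j : tnth (cons_tuple x e) j = tnth e (h j).
    by rewrite /h; case: unliftP => [j' ->|->]/=; rewrite ?tnthS ?tnth0.
  have hE' j : tnth (cons_tuple (tnth e' i0) e') j = tnth e' (h j).
    by rewrite /h; case: unliftP => [j' ->|->]/=; rewrite ?tnthS ?tnth0.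
  split=> [i j|P s]; first by rewrite !hE !hE' ee'.
  by rewrite (map_tuple_comp s hE) (map_tuple_comp s hE') matom.
pose cell_of u : 'I_N.+2 := xchoose (grid_cell_cover N u).
have cell_ofP u : grid_cell N (cell_of u) u by exact: (xchooseP (grid_cell_cover N u)).
(* The configuration to copy: the cells of the atoms of [m] over [x :: e]. *)
pose w := [ffun a : {P : tau & (ar P).-tuple 'I_k.+1} =>
  cell_of (m (tag a) (map_tuple (tnth (cons_tuple x e)) (tagged a)))].
have [x' xe' real] := ext e' w.
exists x'.
have eqc i j : (tnth (cons_tuple x e) i == tnth (cons_tuple x e) j) =
    (tnth (cons_tuple x' e') i == tnth (cons_tuple x' e') j).
  have nx i' : (tnth e i' == x) = false.
    by apply/negbTE; apply: contraNneq xe => <-; exact: mem_tnth.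
  have nx' i' : (tnth e' i' == x') = false.
    by apply/negbTE; apply: contraNneq xe' => <-; exact: mem_tnth.
  case: (unliftP ord0 i) => [i' ->|->]; case: (unliftP ord0 j) => [j' ->|->];
    rewrite ?tnthS ?tnth0 ?eqxx// ?ee' ?nx ?nx'//.
  by rewrite ![_ == tnth _ _]eq_sym nx nx'.
split=> // P s.
have [s0|s0] := boolP (ord0 \in s).
  set t := map_tuple _ s; set t' := map_tuple _ s.
  have fr : fresh_atom e' x' t'.
    apply/andP; split; first by apply/mapP; exists ord0; rewrite ?tnth0.
    by apply/allP => _ /mapP[i _ ->]; exact: (mem_tnth i (cons_tuple x' e')).
  (* The cell prescribed at the normalized indices is that of the atom of [m] at [s] itself. *)
  have /= := real P t' fr; rewrite /w ffunE/= (pattern_indexK _ eqc) => ct'.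
  exact: grid_cell_dist (cell_ofP _) ct'.
(* Without position 0 the atom speaks of [e] alone, and its error is inherited. *)
have /fin_all_exists[g gE] : forall i, exists j, tnth s i = lift ord0 j.
  move=> i; case: (unliftP ord0 (tnth s i)) => [j ->|si0]; first by exists j.
  by move: s0; rewrite -si0 mem_tnth.
have sE (T : Type) (y : T) (f : k.-tuple T) :
    map_tuple (tnth (cons_tuple y f)) s = map_tuple (tnth f) [tuple g i | i < ar P].
  by apply: eq_from_tnth => i; rewrite !tnth_map gE tnthS tnth_ord_tuple.
by rewrite !sE.
Qed.

(** The factor by which a formula may amplify the tolerance. Quantifiers cost nothing, because
    extending similar tuples preserves the tolerance. *)
Fixpoint lip k (f : formula ar k) : R :=
  match f with
  | FAtom _ _ _ | FIdent _ _ _ => 1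
  | FAnd _ f g | FOr _ f g | FImp _ f g => lip f + lip g
  | FNeg _ f => lip f
  | FAll _ f | FEx _ f => lip f
  end.

(* Strictly bounds the size of the environments in which f meets a quantifier. *)
Fixpoint max_scope k (f : formula ar k) : nat :=
  match f with
  | FAtom k _ _ | FIdent k _ _ => 0
  | FAnd _ f g | FOr _ f g | FImp _ f g => maxn (max_scope f) (max_scope g)
  | FNeg _ f => max_scope f
  | FAll k f | FEx k f => maxn k.+1 (max_scope f)
  end.

Lemma lip_gt0 k (f : formula ar k) : 0 < lip f.
Proof. by elim: f => //= *; rewrite addr_gt0. Qed.

Lemma eval_similar N K (M M' : eqType) (x0 : M) (x0' : M')
    (m : model R ar M) (m' : model R ar M') :
    (forall k, (k < K)%N -> extension_prop N k m) ->
    (forall k, (k < K)%N -> extension_prop N k m') ->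
  forall k (f : formula ar k) e e', (max_scope f <= K)%N ->
    similar (N.+1%:R^-1 *+ 2) m m' e e' ->
    `|eval m f e - eval m' f e'| <= lip f * (N.+1%:R^-1 *+ 2).
Proof.
move=> extm extm'; set d := N.+1%:R^-1 *+ 2.
have d0 : 0 <= d by rewrite mulrn_wge0// invr_ge0.
have dlip k (f : formula ar k) : 0 <= lip f * d by rewrite mulr_ge0// ltW// lip_gt0.
(* The hypotheses of [dist_inf_le] and [dist_sup_le] for both quantifiers at once; [x0] and [x0']
   make the ranges nonempty. *)
have step k (f : formula ar k.+1) e e' : (k < K)%N -> similar d m m' e e' ->
    (forall e e', similar d m m' e e' -> `|eval m f e - eval m' f e'| <= lip f * d) ->
    let A := range (fun x => eval m f (cons_tuple x e)) in
    let B := range (fun x => eval m' f (cons_tuple x e')) in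
    [/\ A !=set0 /\ B !=set0, A `<=` `[0, 1], B `<=` `[0, 1],
    (forall x, A x -> exists2 y, B y & `|x - y| <= lip f * d) &
    (forall y, B y -> exists2 x, A x & `|x - y| <= lip f * d)].
  move=> kK ee' IH A B; split.
  - by split; [exists (eval m f (cons_tuple x0 e)), x0
      |exists (eval m' f (cons_tuple x0' e')), x0'].
  - by move=> _ [x _ <-]; rewrite /= in_itv/= eval_itv.
  - by move=> _ [x _ <-]; rewrite /= in_itv/= eval_itv.
  - move=> _ [x _ <-]; have [x' xx'] := similar_extend x (extm' _ kK) ee'.
    by exists (eval m' f (cons_tuple x' e')); [exists x'|exact: IH].
  - move=> _ [x' _ <-].
    have [x xx'] := similar_extend x' (extm _ kK) (similarC ee').
    by exists (eval m f (cons_tuple x e)); [exists x|exact/IH/similarC].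
move=> k; elim=> {k} [k P args|k i j|k f IHf g IHg|k f IHf g IHg|k f IHf g IHg|k f IHf
  |k f IHf|k f IHf] e e' /=; rewrite ?geq_max.
- by move=> _ [_ h]; rewrite mul1r.
- move=> _ [h _]; rewrite mul1r (_ : `[<_>] = `[<tnth e' i = tnth e' j>]) ?subrr ?normr0//.
  by apply: asbool_equiv_eq; split=> /eqP; [rewrite h|rewrite -h] => /eqP.
- move=> /andP[/IHf{}IHf /IHg{}IHg] ee'; rewrite mulrDl.
  move: (IHf _ _ ee') (IHg _ _ ee') (dlip _ f) (dlip _ g).
  by rewrite !ler_norml /Num.min; do 2 case: ltP => ?; lra.
- move=> /andP[/IHf{}IHf /IHg{}IHg] ee'; rewrite mulrDl.
  move: (IHf _ _ ee') (IHg _ _ ee') (dlip _ f) (dlip _ g).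
  by rewrite !ler_norml /Num.max; do 2 case: ltP => ?; lra.
- move=> /andP[/IHf{}IHf /IHg{}IHg] ee'; rewrite mulrDl.
  move: (IHf _ _ ee') (IHg _ _ ee') (dlip _ f) (dlip _ g).
  by rewrite !ler_norml /luk_imp /Num.min; do 2 case: ltP => ?; lra.
- move=> /IHf{}IHf ee'; move: (IHf _ _ ee') (dlip _ f).
  by rewrite !ler_norml /luk_neg; lra.
- move=> /andP[kK /IHf{}IHf] ee'.
  have [[]] := step _ f _ _ kK ee' (fun e e' => IHf e e').
  exact: dist_inf_le.
- move=> /andP[kK /IHf{}IHf] ee'.
  have [[]] := step _ f _ _ kK ee' (fun e e' => IHf e e').
  exact: dist_sup_le.
Qed.

End back_and_forth.

(** * Measurability of truth values, and positive mass of grid cells *)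

Section measurability.
Context (R : realType) (tau : finType) (ar : tau -> nat).

Lemma measurable_unit_val : measurable_fun [set: unit_itv R] (@unit_val R).
Proof.
move=> _ Y mY; rewrite setTI.
by exists Y => //; rewrite setTI.
Qed.

Lemma measurable_atom (M : Type) (P : tau) (t : (ar P).-tuple M) :
  measurable_fun [set: model R ar M] (fun m : model R ar M => m P t).
Proof.
move=> _ Y mY; rewrite setTI; apply: sub_sigma_algebra.
by exists P, t, Y.
Qed.

Lemma measurable_eval n k (f : formula ar k) (e : k.-tuple 'I_n.+1) :
  measurable_fun [set: model R ar 'I_n.+1] (fun m : model R ar 'I_n.+1 => eval m f e).
Proof.
(* Listing the finite domain by natural numbers turns quantifiers into countable infima and suprema
   of measurable functions. *)
have rangeE (h : 'I_n.+1 -> R) :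
    range h = [set h (inord j) | j in [set j | (0 <= j)%N]].
  by apply/seteqP; split=> [_ [x _ <-]|_ [j _ <-]]; [exists x; rewrite ?inord_val|exists (inord j)].
elim: f e => {k} [k P args|k i j|k f IHf g IHg|k f IHf g IHg|k f IHf g IHg|k f IHf
  |k f IHf|k f IHf] e /=.
- by apply: measurableT_comp; [exact: measurable_unit_val|exact: measurable_atom].
- exact: measurable_cst.
- exact: measurable_minr.
- exact: measurable_maxr.
- rewrite /luk_imp; apply: measurable_minr; first exact: measurable_cst.
  by apply: measurable_funD => //; apply: measurable_funB.
- by rewrite /luk_neg; apply: measurable_funB.
- under eq_fun do rewrite rangeE.
  apply: (@measurable_fun_infs _ _ _ _ (fun j m => eval m f (cons_tuple (inord j) e)) 0%N) => //.
  move=> m _; exists 0 => _ [j _ <-].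
  by case/andP: (eval_itv (inord j) m f (cons_tuple (inord j) e)).
- under eq_fun do rewrite rangeE.
  apply: (@measurable_fun_sups _ _ _ _ (fun j m => eval m f (cons_tuple (inord j) e)) 0%N) => //.
  move=> m _; exists 1 => _ [j _ <-].
  by case/andP: (eval_itv (inord j) m f (cons_tuple (inord j) e)).
Qed.

Lemma measurable_grid_cell N i : measurable (grid_cell (R:=R) N i).
Proof.
rewrite (_ : grid_cell _ _ =
  @unit_val R @^-1` `[i%:R / N.+1%:R - N.+1%:R^-1, i%:R / N.+1%:R + N.+1%:R^-1]).
  by rewrite -[X in measurable X]setTI; exact: measurable_unit_val.
by apply/seteqP; split=> u; rewrite /grid_cell /= ler_distl in_itv.
Qed.

Lemma grid_cell_charged N i (p : probability (unit_itv R) R) : (i < N.+2)%N ->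
  charges_intervals p -> (0 < p (grid_cell N i))%E.
Proof.
move=> iN pc; rewrite /grid_cell.
have N0 : 0 < N.+1%:R :> R by rewrite ltr0n.
pose c : R := i%:R / N.+1%:R; pose d : R := N.+1%:R^-1; rewrite -/c -/d.
have d1 : d <= 1 by rewrite invf_le1// ler1n.
have c0 : 0 <= c by rewrite divr_ge0.
have c1 : c <= 1 by rewrite ler_pdivrMr// mul1r ler_nat.
have d0 : 0 < d by rewrite invr_gt0.
(* The cell may stick out of the unit interval, but it always contains [[0, d]] or [[c - d, c]],
   which do not. *)
have cd : c = 0 \/ d <= c.
  have [i0|i_gt0] := posnP i; [by left; rewrite /c i0 mul0r|right].
  by rewrite ler_pdivlMr// mulVf ?gt_eqF// ler1n.
clearbody c d.
pose J := [set x : R | (0 <= x <= 1) && (c - d <= x <= c + d)].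
rewrite (_ : [set _ | _] = @unit_val R @^-1` J); last first.
  by apply/seteqP; split=> u; rewrite /J/preimage/= ler_distl unit_val_itv.
apply: pc.
- move=> x y /andP[/andP[x0 x1] /andP[x2 x3]] /andP[/andP[y0 y1] /andP[y2 y3]] z.
  by move=> /andP[xz zy]; apply/andP; split; apply/andP; split; lra.
- by move=> x /andP[/= + _]; rewrite in_itv.
case: cd => [c0'|dc]; [exists 0, d|exists (c - d), c];
  by split; try (apply/andP; split; apply/andP; split); lra.
Qed.

End measurability.

(** * Independence of events on disjoint sets of atoms *)

Section independence.
Context (R : realType) (tau : finType) (ar : tau -> nat).
Variable p : tau -> probability (unit_itv R) R.
Variable n : nat.

Let box_data := forall P : tau, (ar P).-tuple 'I_n -> set (unit_itv R).

Definition box (A : box_data) : set (model R ar 'I_n) :=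
  [set m | forall P t, A P t (m P t)].

Definition Pr (S : set (model R ar 'I_n)) : R := fine (rho ar p n S).

Lemma PrE (S : set (model R ar 'I_n)) : measurable S -> rho ar p n S = (Pr S)%:E.
Proof. by move=> mS; rewrite /Pr fineK// fin_num_measure. Qed.

Lemma Pr_ge0 (S : set (model R ar 'I_n)) : 0 <= Pr S.
Proof. by rewrite /Pr fine_ge0. Qed.

Lemma le_Pr (S S' : set (model R ar 'I_n)) : measurable S -> measurable S' ->
  S `<=` S' -> Pr S <= Pr S'.
Proof. by move=> mS mS' SS'; rewrite -lee_fin -!PrE// le_measure// inE. Qed.

Lemma Pr_le1 (S : set (model R ar 'I_n)) : measurable S -> Pr S <= 1.
Proof. by move=> mS; rewrite -lee_fin -PrE// probability_le1. Qed.

Lemma PrU_le (S S' : set (model R ar 'I_n)) : measurable S -> measurable S' ->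
  Pr (S `|` S') <= Pr S + Pr S'.
Proof.
move=> mS mS'; rewrite -lee_fin EFinD -!PrE//; first exact: measureU2.
exact: measurableU.
Qed.

Lemma Pr_bigsetU_le (I : Type) (s : seq I) (F : I -> set (model R ar 'I_n)) :
  (forall i, measurable (F i)) ->
  Pr (\big[setU/set0]_(i <- s) F i) <= \sum_(i <- s) Pr (F i).
Proof.
move=> mF; elim: s => [|i s IH]; first by rewrite !big_nil /Pr measure0.
rewrite !big_cons (le_trans (PrU_le _ _))//; first exact: bigsetU_measurable.
by rewrite lerD2l.
Qed.

Lemma PrC (S : set (model R ar 'I_n)) : measurable S -> Pr (~` S) = 1 - Pr S.
Proof.
move=> mS; apply: EFin_inj; rewrite -PrE; last exact: measurableC.
by rewrite probability_setC// PrE.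
Qed.

Lemma PrD (S S' : set (model R ar 'I_n)) : measurable S -> measurable S' ->
  Pr (S `&` ~` S') = Pr S - Pr (S `&` S').
Proof.
move=> mS mS'; apply: EFin_inj; rewrite EFinB -!PrE//; last 2 first.
- exact: measurableI.
- by apply: measurableI => //; exact: measurableC.
by rewrite -setDE measureD//; exact: le_lt_trans (probability_le1 _ mS) (ltry 1).
Qed.

Lemma measurable_box (A : box_data) : (forall P t, measurable (A P t)) -> measurable (box A).
Proof.
move=> mA.
rewrite (_ : box A = \bigcap_(P in [set: tau]) \bigcap_(t in [set: (ar P).-tuple 'I_n])
    ((fun m : model R ar 'I_n => m P t) @^-1` A P t)); last first.
  by apply/seteqP; split=> [m h P _ t _|m h P t]; exact: h.
apply: fin_bigcap_measurable => // P _; apply: fin_bigcap_measurable => // t _.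
by rewrite -[X in measurable X]setTI; exact: measurable_atom.
Qed.

Lemma Pr_box (A : box_data) : (forall P t, measurable (A P t)) ->
  Pr (box A) = \prod_P \prod_t fine (p P (A P t)).
Proof.
move=> mA; rewrite /Pr /box rhoE// -[RHS]/(fine (_%:E)) -prodEFin; congr fine.
apply: eq_bigr => P _; rewrite -prodEFin; apply: eq_bigr => t _.
by rewrite fineK// fin_num_measure.
Qed.

(** The value [setT] stands for the absence of a constraint, so no atom is constrained by both
    boxes. *)
Definition independent_boxes (A B : box_data) :=
  forall P t, A P t = setT \/ B P t = setT.

Lemma Pr_boxI (A B : box_data) : (forall P t, measurable (A P t)) ->
  (forall P t, measurable (B P t)) -> independent_boxes A B ->
  Pr (box (fun P t => A P t `&` B P t)) = Pr (box A) * Pr (box B).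
Proof.
move=> mA mB AB; rewrite !Pr_box//; last by move=> *; exact: measurableI.
rewrite -big_split/=; apply: eq_bigr => P _; rewrite -big_split/=; apply: eq_bigr => t _.
by case: (AB P t) => ->; rewrite ?setTI ?setIT probability_setT /= ?mul1r ?mulr1.
Qed.

(* Inclusion-exclusion, one box at a time: the extra box A absorbs the boxes that
   appear positively, so that only the probabilities of boxes are needed. *)
Lemma Pr_avoid_boxes (I : eqType) (s : seq I) (B : I -> box_data) (A : box_data) :
    (forall P t, measurable (A P t)) -> (forall x P t, measurable (B x P t)) ->
    uniq s -> {in s, forall x, independent_boxes A (B x)} ->
    {in s &, forall x y, x != y -> independent_boxes (B x) (B y)} ->
  Pr (box A `&` \big[setI/setT]_(x <- s) ~` box (B x)) =
  Pr (box A) * \prod_(x <- s) (1 - Pr (box (B x))).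
Proof.
move=> + mB; elim: s A => [|y s IH] A mA; first by rewrite !big_nil setIT mulr1.
rewrite /= => /andP[ys us] AB BB; rewrite !big_cons.
have sub x : x \in s -> x \in y :: s by rewrite inE => ->; rewrite orbT.
have mbox x : measurable (~` box (B x)) by apply: measurableC; exact: measurable_box.
rewrite setIA setIAC PrD; last 2 first.
- apply: measurableI; first exact: measurable_box.
  exact: bigsetI_measurable.
- exact: measurable_box.
rewrite IH//; last 2 first.
- by move=> x /sub xs; exact: AB.
- by move=> x x' /sub xs /sub xs'; exact: BB.
have -> : box A `&` \big[setI/setT]_(x <- s) ~` box (B x) `&` box (B y) =
    box (fun P t => A P t `&` B y P t) `&` \big[setI/setT]_(x <- s) ~` box (B x).
  rewrite setIAC; congr (_ `&` _); apply/seteqP; split=> [m [hA hB] P t|m h]; first by split.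
  by split=> P t; case: (h P t).
rewrite IH//; last 3 first.
- by move=> *; exact: measurableI.
(* Where [A] imposes nothing the merged box reduces to [B y], and [y] differs from [x] by
   uniqueness. *)
- move=> x xs P t; have [->|] := AB x (sub _ xs) P t; last by right.
  have yx : y != x by apply: contraNneq ys => ->.
  rewrite setTI.
  exact: BB (mem_head _ _) (sub _ xs) yx P t.
- by move=> x x' /sub xs /sub xs'; exact: BB.
rewrite Pr_boxI//; last by apply: AB; exact: mem_head.
by rewrite mulrBl mul1r mulrBr !mulrA.
Qed.

End independence.

(** Writing [q] as [expR (- l)], the Taylor term of degree [k.+1] of the exponential beats [n ^ k]
    with one power to spare, leaving [C / (n + 1)]. *)
Lemma cvg_poly_geometric (R : realType) k (q : R) : 0 < q < 1 ->
  (n%:R ^+ k * q ^+ n) @[n --> \oo] --> 0.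
Proof.
move=> /andP[q0 q1].
pose l : R := - ln q.
have l0 : 0 < l by rewrite oppr_gt0 ln_lt0// q0.
pose C : R := k.+1`!%:R / l ^+ k.+1 / q.
have qE n : q ^+ n = expR (- (l * n%:R)).
  by rewrite /l mulNr opprK expRM_natr lnK.
have bound n : n%:R ^+ k * q ^+ n <= C * n.+1%:R^-1.
  (* Using [n.+1] avoids dividing by 0 at [n = 0]; the extra factor [q] is paid for in [C]. *)
  have h : (l * n.+1%:R) ^+ k.+1 / k.+1`!%:R <= expR (l * n.+1%:R).
    have ln0 : 0 <= l * n.+1%:R by rewrite mulr_ge0// ltW.
    by apply: le_trans (expR_ge1Dxn k ln0); rewrite lerDr.
  have {}h : (l * n.+1%:R) ^+ k.+1 / k.+1`!%:R * q ^+ n.+1 <= 1.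
    by rewrite -(ler_pM2r (exprn_gt0 n.+1 q0)) [leRHS]mulrC qE -expRD addNr expR0 -qE in h.
  have l0' : 0 < l ^+ k.+1 by exact: exprn_gt0.
  have f0 : 0 < k.+1`!%:R :> R by rewrite ltr0n fact_gt0.
  apply: (@le_trans _ _ (n.+1%:R ^+ k * q ^+ n)).
    by rewrite ler_pM2r ?exprn_gt0// lerXn2r ?nnegrE// ler_nat.
  rewrite ler_pdivlMr ?ltr0n// /C ler_pdivlMr// ler_pdivlMr//.
  rewrite mulrAC ler_pdivrMr// mul1r exprMn in h.
  move: h; apply: le_trans; rewrite !exprS.
  by rewrite le_eqVlt; apply/orP; left; apply/eqP; ring.
apply: (@squeeze_cvgr _ _ _ _ (fun=> 0) (fun n => C * n.+1%:R^-1)).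
- by apply: nearW => n; rewrite bound mulr_ge0// exprn_ge0// ltW.
- exact: cvg_cst.
- rewrite -(mulr0 C); apply: cvgMr; exact: cvg_harmonic.
Qed.

(** * The extension property fails with vanishing probability *)

Section extension_probability.
Context (R : realType) (tau : finType) (ar : tau -> nat).
Variable p : tau -> probability (unit_itv R) R.
Hypothesis p_charges : forall P : tau, charges_intervals (p P).
Variables N k : nat.

Let pattern := {ffun {P : tau & (ar P).-tuple 'I_k.+1} -> 'I_N.+2}.

Definition pattern_set (w : pattern) P (s : (ar P).-tuple 'I_k.+1) : set (unit_itv R) :=
  grid_cell N (w (Tagged (fun P => (ar P).-tuple 'I_k.+1) s)).

(** A lower bound, uniform in the domain and in the fresh element, for the probability of realizing
    [w]. *)
Definition pattern_prob (w : pattern) : R :=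
  \prod_P \prod_(s : (ar P).-tuple 'I_k.+1) fine (p P (pattern_set w s)).

Lemma pattern_set_prob w P (s : (ar P).-tuple 'I_k.+1) :
  0 < fine (p P (pattern_set w s)) <= 1.
Proof.
have mc : measurable (pattern_set w s) by exact: measurable_grid_cell.
rewrite -lte_fin -lee_fin fineK ?fin_num_measure//.
by rewrite probability_le1// andbT; apply: grid_cell_charged.
Qed.

Lemma pattern_prob_itv w : 0 < pattern_prob w <= 1.
Proof.
apply/andP; split.
  by apply: prodr_gt0 => P _; apply: prodr_gt0 => s _; case/andP: (pattern_set_prob w s).
apply: prodr_ile1 => P _; apply/andP; split.
  by apply: prodr_ge0 => s _; case/andP: (pattern_set_prob w s) => /ltW.
by apply: prodr_ile1 => s _; case/andP: (pattern_set_prob w s) => /ltW -> ->.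
Qed.

Section domain.
Variable n : nat.
Variables (e : k.-tuple 'I_n) (w : pattern).

Definition pattern_box (x : 'I_n) (P : tau) (t : (ar P).-tuple 'I_n) : set (unit_itv R) :=
  if fresh_atom e x t then pattern_set w (pattern_index (cons_tuple x e) t) else setT.

Lemma measurable_pattern_box x P t : measurable (@pattern_box x P t).
Proof. by rewrite /pattern_box; case: ifP => // _; exact: measurable_grid_cell. Qed.

(** The entries of a fresh atom lie in [x :: e], so they can be read back from their indices. *)
Lemma pattern_index_inj x r :
  {in [pred t : r.-tuple 'I_n | fresh_atom e x t] &,
    injective (pattern_index (cons_tuple x e) (r := r))}.
Proof.
move=> t t' /andP[_ /allP te] /andP[_ /allP te'] tt'.
apply: eq_from_tnth => i.
have := congr1 (fun v : r.-tuple 'I_k.+1 => nth x (x :: e) (tnth v i)) tt'.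
rewrite !tnth_map.
have lt y : y \in x :: e -> (index y (cons_tuple x e) < k.+1)%N.
  by rewrite -index_mem /= size_tuple.
have it := te _ (mem_tnth i t); have it' := te' _ (mem_tnth i t').
by rewrite !inordK ?lt// !nth_index.
Qed.

(** Constrained atoms correspond injectively to index tuples and unconstrained ones contribute 1.
    The index tuples that are not hit only add factors at most 1 on the left. *)
Lemma le_pattern_prob x : pattern_prob w <= Pr p (box (@pattern_box x)).
Proof.
rewrite Pr_box; last exact: measurable_pattern_box.
apply: ler_prod => P _; apply/andP; split.
  by apply: prodr_ge0 => s _; case/andP: (pattern_set_prob w s) => /ltW.
pose g (s : (ar P).-tuple 'I_k.+1) := fine (p P (pattern_set w s)).
pose F := [pred t : (ar P).-tuple 'I_n | fresh_atom e x t].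
rewrite [leRHS](_ : _ = \prod_(t in F) g (pattern_index (cons_tuple x e) t)); last first.
  rewrite [RHS]big_mkcond/=; apply: eq_bigr => t _; rewrite /pattern_box inE/=.
  by case: ifP => // _; rewrite probability_setT.
rewrite -(big_imset g (@pattern_index_inj x (ar P))).
rewrite [leRHS]big_mkcond/=; apply: ler_prod => s _.
have /andP[s0 s1] := pattern_set_prob w s.
by case: ifP => _; rewrite ?lexx ltW.
Qed.

Definition unrealized : set (model R ar 'I_n) :=
  \big[setI/setT]_(x <- enum [predC e]) ~` box (@pattern_box x).

Lemma measurable_unrealized : measurable unrealized.
Proof.
apply: bigsetI_measurable => x _; apply: measurableC; apply: measurable_box.
exact: measurable_pattern_box.
Qed.

(* Half of pattern_prob, lest decay be 0: decay ^+ k is a denominator below. *)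
Definition decay : R := 1 - pattern_prob w / 2.

Lemma decay_itv : 0 < decay < 1.
Proof. by rewrite /decay; case/andP: (pattern_prob_itv w); lra. Qed.

(** At least [n - k] fresh elements fail independently, each with probability at most [decay]. The
    quotient form stays valid when [n < k]. *)
Lemma Pr_unrealized_le : Pr p unrealized <= decay ^+ n / decay ^+ k.
Proof.
have /andP[q0 q1] := decay_itv; have /andP[c0 c1] := pattern_prob_itv w.
have boxT : box (fun P (t : (ar P).-tuple 'I_n) => [set: unit_itv R]) = setT.
  by apply/seteqP; split.
have PrT : Pr p [set: model R ar 'I_n] = 1 by rewrite /Pr probability_setT.
have := @Pr_avoid_boxes _ _ _ p n _ (enum [predC e]) pattern_box (fun _ _ => setT).
rewrite boxT setTI PrT mul1r => -> //; last 4 first.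
- by move=> x P t; exact: measurable_pattern_box.
- exact: enum_uniq.
- by move=> x _ P t; left.
(* An atom fresh for both contains [y] and only entries of [x :: e], which forces [y = x]. *)
- move=> x y; rewrite !mem_enum !inE => xe ye xy P t; rewrite /pattern_box.
  case: ifP => [fx|_]; last by left.
  case: ifP => [fy|_]; last by right.
  move/andP: fx => [_ /allP tx]; move/andP: fy => [/tx + _].
  by rewrite !inE (negbTE ye) orbF eq_sym (negbTE xy).
apply: (@le_trans _ _ (decay ^+ #|[predC e]|)).
  rewrite big_enum -prodr_const; apply: ler_prod => x _.
  rewrite subr_ge0 Pr_le1/=; last by apply: measurable_box; exact: measurable_pattern_box.
  by rewrite /decay; have := le_pattern_prob x; lra.
rewrite ler_pdivlMr ?exprn_gt0// -exprD ler_wiXn2l// ?ltW//.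
rewrite -[leqLHS]card_ord -(cardC (mem e)) addnC leq_add2l.
by rewrite (leq_trans (card_size _))// size_tuple.
Qed.

Lemma realized (m : model R ar 'I_n) : ~ unrealized m ->
  exists2 x, x \notin e & realizes N m e (fun a => w a) x.
Proof.
move=> mu; apply: contrapT => nex; apply: mu.
rewrite /unrealized -bigcap_seq => x /=; rewrite mem_enum inE => xe bx; apply: nex.
exists x => // P t fr; by have := bx P t; rewrite /pattern_box fr.
Qed.

End domain.

Definition no_extension n : set (model R ar 'I_n) :=
  \big[setU/set0]_(ew <- enum {: k.-tuple 'I_n * pattern}) unrealized ew.1 ew.2.

Lemma measurable_no_extension n : measurable (@no_extension n).
Proof. by apply: bigsetU_measurable => ew _; exact: measurable_unrealized. Qed.

Lemma extension_propP n (m : model R ar 'I_n) :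
  ~ no_extension m -> extension_prop N k m.
Proof.
move=> mE e w; apply: realized => mu; apply: mE.
by rewrite /no_extension -bigcup_seq; exists (e, w) => //=; rewrite mem_enum.
Qed.

(** Union bound: [n ^ k] tuples and a number of patterns independent of [n], against geometric decay
    for each pattern. *)
Lemma cvg_Pr_no_extension : Pr p (@no_extension n) @[n --> \oo] --> 0.
Proof.
pose b n := \sum_(w : pattern) (decay w ^- k * (n%:R ^+ k * decay w ^+ n)).
apply: (@squeeze_cvgr _ _ _ _ (fun=> 0) b).
- apply: nearW => n; rewrite Pr_ge0/=.
  apply: (le_trans (Pr_bigsetU_le _ _ _)) => [ew|]; first exact: measurable_unrealized.
  apply: (@le_trans _ _ (\sum_(ew : k.-tuple 'I_n * pattern) decay ew.2 ^+ n / decay ew.2 ^+ k)).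
    by rewrite big_enum/=; apply: ler_sum => ew _; exact: Pr_unrealized_le.
  rewrite -(pair_big predT predT (fun (_ : k.-tuple 'I_n) w => decay w ^+ n / decay w ^+ k))/=.
  rewrite sumr_const card_tuple card_ord -mulr_natl mulr_sumr.
  apply: ler_sum => w _; rewrite natrX [_ ^- _ * _]mulrC mulrA//.
- exact: cvg_cst.
- rewrite (_ : 0 = \sum_(w : pattern) (decay w ^- k * 0)); last first.
    by rewrite big1// => w _; rewrite mulr0.
  apply: cvg_big => [|w _]; first exact: add_continuous.
  apply: cvgMr; apply: cvg_poly_geometric; exact: decay_itv.
Qed.

End extension_probability.

(** * Concentration of the truth value and its limit *)

Section limit_value.
Context (R : realType) (tau : finType) (ar : tau -> nat).
Hypothesis ar_gt0 : forall P : tau, (0 < ar P)%N.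
Variable p : tau -> probability (unit_itv R) R.
Hypothesis p_charges : forall P : tau, charges_intervals (p P).
Variable phi : sentence ar.

Definition bad_model N n : set (model R ar 'I_n) :=
  \big[setU/set0]_(k < max_scope phi) @no_extension R tau ar N k n.

Definition tolerance N : R := lip R phi * (N.+1%:R^-1 *+ 2).

Lemma measurable_bad_model N n : measurable (@bad_model N n).
Proof. by apply: bigsetU_measurable => k _; exact: measurable_no_extension. Qed.

Lemma cvg_Pr_bad_model N : Pr p (@bad_model N n) @[n --> \oo] --> 0.
Proof.
pose b n := \sum_(k < max_scope phi) Pr p (@no_extension R tau ar N k n).
apply: (@squeeze_cvgr _ _ _ _ (fun=> 0) b).
- apply: nearW => n; rewrite Pr_ge0/=.
  by apply: Pr_bigsetU_le => k; exact: measurable_no_extension.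
- exact: cvg_cst.
- rewrite (_ : 0 = \sum_(k < max_scope phi) 0); last by rewrite big1.
  apply: cvg_big => [|k _]; first exact: add_continuous.
  exact: cvg_Pr_no_extension.
Qed.

Lemma truth_value_close N n n' (m : model R ar 'I_n.+1) (m' : model R ar 'I_n'.+1) :
  ~ bad_model N m -> ~ bad_model N m' ->
  `|truth_value m phi - truth_value m' phi| <= tolerance N.
Proof.
have ext j (u : model R ar 'I_j) : ~ bad_model N u ->
    forall k, (k < max_scope phi)%N -> extension_prop N k u.
  move=> nb k kK; apply: extension_propP => uk; apply: nb.
  rewrite /bad_model -(bigcup_mkord _ (fun k => @no_extension R tau ar N k j)).
  by exists k.
move=> /ext extm /ext extm'.
(* The empty tuples are similar: with positive arity, an atom over them would need an index in
   ['I_0]. *)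
apply: (eval_similar ord0 ord0 extm extm') => //; split=> [[]//|P s].
by case: (tnth s (Ordinal (ar_gt0 P))).
Qed.

(** For large [n] both bad events have probability below 1/2, so they do not cover all models. A
    common good model links two levels of tolerance. *)
Lemma good_model2 N N' : exists n (m : model R ar 'I_n.+1),
  ~ bad_model N m /\ ~ bad_model N' m.
Proof.
have h : \forall n \near \oo, Pr p (@bad_model N n) < 1 / 2.
  by apply: cvgr_lt (cvg_Pr_bad_model N) _ _; lra.
have h' : \forall n \near \oo, Pr p (@bad_model N' n) < 1 / 2.
  by apply: cvgr_lt (cvg_Pr_bad_model N') _ _; lra.
have [n [[hn hn'] n0]] : exists n, (Pr p (@bad_model N n) < 1 / 2 /\
    Pr p (@bad_model N' n) < 1 / 2) /\ (0 < n)%N.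
  near \oo => n; exists n; split; last by near: n; exact: nbhs_infty_gt.
  by split; near: n.
case: n n0 hn hn' => // n _ hn hn'; exists n; apply: contrapT => nex.
have mb := @measurable_bad_model N n.+1; have mb' := @measurable_bad_model N' n.+1.
have := PrU_le p mb mb'.
rewrite (_ : _ `|` _ = setT); first by rewrite {1}/Pr probability_setT /=; lra.
apply/seteqP; split=> // m _; apply: contrapT => /not_orP[bm bm'].
by apply: nex; exists m.
Unshelve. all: by end_near. Qed.

Lemma tolerance_lt eps : 0 < eps -> exists N, tolerance N < eps.
Proof.
move=> e0; have L0 := lip_gt0 R phi.
exists (Num.truncn (lip R phi *+ 2 / eps)); set N := Num.truncn _.
have : lip R phi *+ 2 / eps < N.+1%:R by exact: truncnS_gt.
rewrite ltr_pdivrMr// => h.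
by rewrite /tolerance mulrnAr -mulrnAl ltr_pdivrMr// mulrC.
Qed.

Lemma truth_value_itv n (m : model R ar 'I_n.+1) : 0 <= truth_value m phi <= 1.
Proof. exact: (eval_itv ord0). Qed.

(** Let [v N] be the value in some good model of level [N]. The intervals of radius [tolerance N]
    around [v N] meet pairwise through common good models, so the supremum of their left ends lies
    in all of them. *)
Lemma limit_truth_value : exists a : R, 0 <= a <= 1 /\
  forall N n (m : model R ar 'I_n.+1), ~ bad_model N m ->
    `|truth_value m phi - a| <= tolerance N *+ 2.
Proof.
have /choice[v vP] : forall N, exists v : R, exists n (m : model R ar 'I_n.+1),
    ~ bad_model N m /\ truth_value m phi = v.
  by move=> N; have [n [m [bm _]]] := good_model2 N N; exists (truth_value m phi), n, m.
have vclose N n (m : model R ar 'I_n.+1) : ~ bad_model N m ->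
    `|truth_value m phi - v N| <= tolerance N.
  by move=> bm; have [n' [m' [bm' <-]]] := vP N; exact: truth_value_close.
have cross i j : v i - tolerance i <= v j + tolerance j.
  have [n [m [/vclose + /vclose]]] := good_model2 i j.
  by rewrite !ler_distl; lra.
pose A := range (fun i => v i - tolerance i).
have A0 : A !=set0 by exists (v 0%N - tolerance 0), 0%N.
have av j : `|v j - sup A| <= tolerance j.
  rewrite distrC ler_distl; apply/andP; split.
    apply: ub_le_sup; last by exists j.
    by exists (v 0%N + tolerance 0) => _ [i _ <-].
  by apply: ge_sup => // _ [i _ <-].
have v01 j : 0 <= v j <= 1.
  by have [n [m [_ <-]]] := vP j; exact: truth_value_itv.
exists (sup A); split.
  (* The supremum is approximated arbitrarily well by values [v j] in the unit interval. *)
  apply/andP; split; apply/ler_addgt0Pr => eps /tolerance_lt[j tj];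
    by move: (av j) (v01 j); rewrite ler_distl; lra.
move=> N n m /vclose; have := av N.
rewrite mulr2n => h1 h2; rewrite (le_trans (ler_distD (v N) _ _))// lerD//.
Qed.

Lemma measurable_truth_value n (V : set R) : measurable V ->
  measurable [set m : model R ar 'I_n.+1 | V (truth_value m phi)].
Proof.
move=> mV; rewrite -[X in measurable X]setTI.
exact: (@measurable_eval R tau ar n 0 phi [tuple]).
Qed.

Lemma mu_squeeze (f : nat -> \bar R) (V : set R) : measurable V ->
    (\forall n \near \oo, (f n <= mu p n phi V)%E) ->
    f n @[n --> \oo] --> 1%E -> mu p n phi V @[n --> \oo] --> 1%E.
Proof.
move=> mV fle fcvg; apply: (squeeze_cvge _ fcvg (cvg_cst _)).
apply: filterS2 (nbhs_infty_gt 0) fle => -[//|n] _ -> /=.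
by apply: probability_le1; exact: measurable_truth_value.
Qed.

Lemma le_mu n (V W : set R) : (0 < n)%N -> measurable V -> measurable W -> V `<=` W ->
  (mu p n phi V <= mu p n phi W)%E.
Proof.
case: n => // n _ mV mW VW.
by apply: le_measure; rewrite ?inE; [exact: measurable_truth_value..|move=> m /VW].
Qed.

Lemma ballE (a eps : R) : [set x | `|x - a| < eps] = `]a - eps, a + eps[%classic.
Proof. by apply/seteqP; split=> x; rewrite /= in_itv/= ltr_distl. Qed.

Lemma cvg_mu_ball_open (a : R) :
  (forall eps : R, 0 < eps -> mu p n phi [set x | `|x - a| < eps] @[n --> \oo] --> 1%E) ->
  forall V : set R, open V -> V a -> mu p n phi V @[n --> \oo] --> 1%E.
Proof.
move=> h V oV Va.
have [eps /= eps0 ball_V] : nbhs_ball a V by rewrite nbhs_ballE; exact: open_nbhs_nbhs.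
apply: (mu_squeeze _ _ (h _ eps0)); first exact: open_measurable.
apply: filterS (nbhs_infty_gt 0) => n n0; apply: le_mu => //.
- by rewrite ballE; exact: measurable_itv.
- exact: open_measurable.
- by move=> x /= xa; apply: ball_V; rewrite /ball/= distrC.
Qed.

Lemma cvg_mu_ball (a : R) :
    (forall N n (m : model R ar 'I_n.+1), ~ bad_model N m ->
      `|truth_value m phi - a| <= tolerance N *+ 2) ->
  forall eps : R, 0 < eps -> mu p n phi [set x | `|x - a| < eps] @[n --> \oo] --> 1%E.
Proof.
move=> close eps eps0.
(* Good models of level [N] are within twice the tolerance of [a], hence the half. *)
have /tolerance_lt[N tN] : 0 < eps / 2 by rewrite divr_gt0.
apply: (@mu_squeeze (fun n => (1 - Pr p (@bad_model N n))%:E)).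
- by rewrite ballE; exact: measurable_itv.
- apply: filterS (nbhs_infty_gt 0) => -[//|n] _; have mb := @measurable_bad_model N n.+1.
  rewrite -PrC// -PrE; last exact: measurableC.
  apply: le_measure; rewrite ?inE; first exact: measurableC.
    by apply: measurable_truth_value; rewrite ballE; exact: measurable_itv.
  move=> m /= /close; rewrite mulr2n => h; apply: (le_lt_trans h).
  by rewrite [ltRHS]splitr ltrD.
- apply: cvg_EFin; first exact: nearW.
  rewrite -[X in _ --> X]subr0; apply: cvgB; first exact: cvg_cst.
  exact: cvg_Pr_bad_model.
Qed.

(** If [a < b], the open rays on either side of the midpoint are disjoint, yet each eventually has
    probability above 1/2. *)
Lemma limit_value_le (a b : R) :
    (forall V : set R, open V -> is_interval V -> V a ->
       mu p n phi V @[n --> \oo] --> 1%E) ->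
    (forall V : set R, open V -> is_interval V -> V b ->
       mu p n phi V @[n --> \oo] --> 1%E) ->
  b <= a.
Proof.
move=> ha hb; rewrite leNgt; apply/negP => ab.
pose c := (a + b) / 2.
have half V : mu p n phi V @[n --> \oo] --> 1%E ->
    \forall n \near \oo, 1 / 2 < fine (mu p n phi V).
  by move=> /fine_cvg h; apply: (cvgr_gt _ h); rewrite /=; lra.
have ca : \forall n \near \oo, 1 / 2 < fine (mu p n phi `]-oo, c[).
  apply/half/ha; [exact: interval_open|exact: interval_is_interval|].
  by rewrite /= in_itv/= /c; lra.
have cb : \forall n \near \oo, 1 / 2 < fine (mu p n phi `]c, +oo[).
  apply/half/hb; [exact: interval_open|exact: interval_is_interval|].
  by rewrite /= in_itv/= andbT /c; lra.
have [n [[hn hn'] n0]] : exists n, (1 / 2 < fine (mu p n phi `]-oo, c[) /\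
    1 / 2 < fine (mu p n phi `]c, +oo[)) /\ (0 < n)%N.
  near \oo => n; exists n; split; last by near: n; exact: nbhs_infty_gt.
  by split; near: n.
case: n n0 hn hn' => // n _.
have m1 := @measurable_truth_value n _ (measurable_itv `]-oo, c[).
have m2 := @measurable_truth_value n _ (measurable_itv `]c, +oo[).
rewrite /mu -/(Pr p _) -/(Pr p _) => h1 h2.
have := le_Pr p m1 (measurableC m2).
rewrite PrC// => H.
suff /H : [set m : model R ar 'I_n.+1 | `]-oo, c[%classic (truth_value m phi)] `<=`
  ~` [set m | `]c, +oo[%classic (truth_value m phi)] by lra.
by move=> m /=; rewrite !in_itv/= andbT => h; apply/negP; rewrite -leNgt ltW.
Unshelve. all: by end_near. Qed.

End limit_value.

Theorem theorem5p1 (R : realType) (tau : finType) (ar : tau -> nat)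
    (ar_gt0 : forall P : tau, (0 < ar P)%N)
    (p : tau -> probability (unit_itv R) R)
    (p_charges : forall P : tau, charges_intervals (p P))
    (phi : sentence ar) :
  (exists! a : R, 0 <= a <= 1 /\
     forall V : set R, open V -> is_interval V -> V a ->
       mu p n phi V @[n --> \oo] --> 1%E) /\
  (forall a : R, 0 <= a <= 1 ->
     (forall V : set R, open V -> is_interval V -> V a ->
       mu p n phi V @[n --> \oo] --> 1%E) <->
     (forall eps : R, 0 < eps ->
       mu p n phi [set x | `|x - a| < eps] @[n --> \oo] --> 1%E)).
Proof.
split; last first.
  move=> a _; split=> [h eps eps0|h V oV _ Va]; last exact: cvg_mu_ball_open h V oV Va.
  rewrite ballE; apply: h; [exact: interval_open|exact: interval_is_interval|].
  by rewrite /= in_itv/=; lra.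
have [a [a01 close]] := limit_truth_value ar_gt0 p_charges phi.
have ha := cvg_mu_ball_open (cvg_mu_ball p_charges close).
exists a; split; first by split=> // V oV _; exact: ha.
move=> b [_ hb]; have {}ha (V : set R) : open V -> is_interval V -> V a ->
    mu p n phi V @[n --> \oo] --> 1%E by move=> oV _; exact: ha.
by apply/le_anti; rewrite (limit_value_le ha hb) (limit_value_le hb ha).
Qed.
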